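(* Let $X,Y$ be bounded degree simplicial complexes, where $X$ has dimension $d$ and $Y$ is uniformly $k$-connected for all $1\le k\leq d$. If there is a regular map $X^0\to Y^0$, then for all $q\geq 1$, ${}_s\mathrm{TO}^q_X(r)\lesssim {}_s\mathrm{TO}^q_Y(r)$.
   Context: An abstract simplicial complex is a pair $(S,\mathcal S)$ where $\mathcal S$ is a collection of finite subsets of $S$ containing all singletons and closed under taking subsets; degree is $\max_{s}|\{t\neq s:\{s,t\}\in\mathcal S\}|$, dimension is $\max_{U\in\mathcal S}|U|-1$. A simplicial complex is the topological realisation $\{f:S\to[0,1]:\mathrm{supp}(f)\in\mathcal S,\sum_s f(s)=1\}$ (subspace topology of $[0,1]^S$); it is bounded degree if $S$ is countable and the degree is finite. It carries the metric $d(f,f')=\inf\{\sum_{i=1}^k\|f_{i-1}-f_i\|_2 : f_0=f, f_k=f', \mathrm{supp}(f_{i-1})\cup\mathrm{supp}(f_i)\in\mathcal S\}$. $X^0$ denotes the set of $0$-simplices with the shortest path metric of the $1$-skeleton; $|Z|$ is the number of $0$-simplices; closed simplices are sets of points whose support lies in a fixed element of $\mathcal S$; $Z\le X$ means there is an injection of $0$-simplices of $Z$ into those of $X$ sending simplices to simplices. For finite $Z$ and continuous $f:Z\to\mathbb R^q$, ${}_s\mathrm{Ov}(f)=\max_{z}|\{\sigma\text{ closed simplex of }Z: z\in f(\sigma)\}|$, ${}_s\mathrm{TO}^q(Z)=\min_f {}_s\mathrm{Ov}(f)$, and ${}_s\mathrm{TO}^q_X(r)=\max\{{}_s\mathrm{TO}^q(Z):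 Z\le X, |Z|\le r\}$. A map $X^0\to Y^0$ is regular if it is Lipschitz and preimages of points have uniformly bounded cardinality. A metric space $Y$ is uniformly $k$-connected if for every $s$ there is $S$ such that every continuous $f:S^{k-1}\to Y$ with image of diameter at most $s$ extends to a continuous $g:D^k\to Y$ with image of diameter at most $S$. For $f,g:\mathbb N\to[0,\infty)$, $f\lesssim g$ means there is $C$ with $f(r)\le Cg(Cr)+C$ for all $r$. *)

(* Defs.v *)
From HB Require Import structures.
From mathcomp Require Import all_boot all_order all_algebra.
From mathcomp Require Import finmap.
From mathcomp Require Import all_classical all_reals all_analysis.
Set Implicit Arguments.
Unset Strict Implicit.
Unset Printing Implicit Defensive.
Import Order.TTheory GRing.Theory Num.Theory.
Local Open Scope classical_set_scope.
Local Open Scope ring_scope.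

Definition asc (S : choiceType) (simp : set {fset S}) : Prop :=
  (forall s : S, simp [fset s]%fset) /\
  (forall A B : {fset S}, simp A -> (forall x, x \in B -> x \in A) -> simp B).

(* finite degree (S is required to be countable by using a countType) *)
Definition bounded_degree (S : countType) (simp : set {fset S}) : Prop :=
  exists D : nat, forall (s : S) (F : {fset S}),
    (forall t, t \in F -> t != s /\ simp [fset s; t]%fset) -> (#|` F| <= D)%N.

Definition dimension (S : choiceType) (simp : set {fset S}) (d : nat) : Prop :=
  (exists U, simp U /\ #|` U| = d.+1) /\ (forall U, simp U -> (#|` U| <= d.+1)%N).

Section Realisation.
Variables (R : realType) (S : choiceType).

Definition supp_is (f : S -> R) (U : {fset S}) : Prop :=
  forall s, f s != 0 <-> s \in U.

Definition realpt (simp : set {fset S}) (f : S -> R) : Prop :=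
  (forall s, 0 <= f s <= 1) /\
  exists U, simp U /\ supp_is f U /\ \sum_(s <- U) f s = 1.

Definition adj (simp : set {fset S}) (f g : S -> R) : Prop :=
  exists W, simp W /\ forall s, (f s != 0 \/ g s != 0) <-> s \in W.

Definition l2dist (f g : S -> R) : R :=
  Num.sqrt (sup [set (\sum_(s <- F) (f s - g s) ^+ 2) | F in [set: {fset S}]]).

Definition zpt : S -> R := fun _ => 0.

Definition chain_len (c : seq (S -> R)) : R :=
  \sum_(i < (size c).-1) l2dist (nth zpt c i) (nth zpt c i.+1).

Definition is_chain (simp : set {fset S}) (c : seq (S -> R)) (f g : S -> R) : Prop :=
  (0 < size c)%N /\ nth zpt c 0 = f /\ nth zpt c (size c).-1 = g /\
  (forall i, (i < size c)%N -> realpt simp (nth zpt c i)) /\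
  (forall i, (i.+1 < size c)%N -> adj simp (nth zpt c i) (nth zpt c i.+1)).

(* the metric d (value +oo when no chain exists) *)
Definition cdist (simp : set {fset S}) (f g : S -> R) : \bar R :=
  ereal_inf [set (chain_len c)%:E | c in [set c | is_chain simp c f g]].

End Realisation.

Definition enorm (R : realType) (k : nat) (x : 'rV[R]_k) : R :=
  Num.sqrt (\sum_(i < k) x ord0 i ^+ 2).

Definition sphere (R : realType) (k : nat) : set 'rV[R]_k :=
  [set x | enorm x = 1].
Definition disk (R : realType) (k : nat) : set 'rV[R]_k :=
  [set x | enorm x <= 1].

Definition cont_into (R : realType) (S : choiceType) (simp : set {fset S}) (k : nat)
  (A : set 'rV[R]_k) (f : 'rV[R]_k -> S -> R) : Prop :=
  forall x, A x -> forall e : R, 0 < e -> exists2 del : R, 0 < del &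
    forall y, A y -> enorm (x - y) < del -> (cdist simp (f x) (f y) < e%:E)%E.

Definition cdiam (R : realType) (S : choiceType) (simp : set {fset S}) (k : nat)
  (A : set 'rV[R]_k) (f : 'rV[R]_k -> S -> R) : \bar R :=
  ereal_sup [set e | exists x y, A x /\ A y /\ e = cdist simp (f x) (f y)].

Definition unif_connected (R : realType) (S : choiceType) (simp : set {fset S})
  (k : nat) : Prop :=
  forall s : R, exists S' : R, forall f : 'rV[R]_k -> S -> R,
    (forall x, sphere x -> realpt simp (f x)) ->
    cont_into simp (@sphere R k) f ->
    (cdiam simp (@sphere R k) f <= s%:E)%E ->
    exists g : 'rV[R]_k -> S -> R,
      (forall x, disk x -> realpt simp (g x)) /\
      cont_into simp (@disk R k) g /\
      (forall x, sphere x -> g x = f x) /\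
      (cdiam simp (@disk R k) g <= S'%:E)%E.

Definition epath (S : choiceType) (simp : set {fset S}) (a b : S) (m : nat) : Prop :=
  exists c : seq S, size c = m.+1 /\ nth a c 0 = a /\ nth a c m = b /\
    forall i, (i < m)%N -> simp [fset nth a c i; nth a c i.+1]%fset.

(* shortest-path metric of the 1-skeleton (+oo between components) *)
Definition gdist (R : realType) (S : choiceType) (simp : set {fset S}) (a b : S) : \bar R :=
  ereal_inf [set ((m%:R : R)%:E) | m in [set m | epath simp a b m]].

Definition regular (R : realType) (SX SY : choiceType) (simpX : set {fset SX})
  (simpY : set {fset SY}) (phi : SX -> SY) : Prop :=
  (exists L : R, 0 < L /\ forall a b,
      (gdist R simpY (phi a) (phi b) <= L%:E * gdist R simpX a b)%E) /\
  (exists N : nat, forall (y : SY) (F : {fset SX}),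
      (forall x, x \in F -> phi x = y) -> (#|` F| <= N)%N).

(* ---------- Finite complexes (vertex set 'I_n, so |Z| = n) and overlap ---------- *)
Definition fasc (n : nat) (simp : {set {set 'I_n}}) : Prop :=
  (forall i, [set i]%SET \in simp) /\
  (forall A B : {set 'I_n}, A \in simp -> B \subset A -> B \in simp).

Definition fpt (R : realType) (n : nat) (simp : {set {set 'I_n}}) (x : 'I_n -> R) : Prop :=
  (forall i, 0 <= x i <= 1) /\
  exists2 U, U \in simp & (forall i, x i != 0 <-> i \in U) /\ \sum_(i in U) x i = 1.

(* continuity for the subspace topology of [0,1]^n *)
Definition fcont (R : realType) (n : nat) (simp : {set {set 'I_n}}) (q : nat)
  (f : ('I_n -> R) -> 'rV[R]_q) : Prop :=
  forall x, fpt simp x -> forall e : R, 0 < e -> exists2 del : R, 0 < del &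
    forall y, fpt simp y -> (forall i, `|x i - y i| < del) -> enorm (f x - f y) < e.

Definition in_img (R : realType) (n : nat) (simp : {set {set 'I_n}}) (q : nat)
  (f : ('I_n -> R) -> 'rV[R]_q) (U : {set 'I_n}) (z : 'rV[R]_q) : Prop :=
  exists x, fpt simp x /\ (forall i, x i != 0 -> i \in U) /\ f x = z.

Definition sOv (R : realType) (n : nat) (simp : {set {set 'I_n}}) (q : nat)
  (f : ('I_n -> R) -> 'rV[R]_q) : R :=
  sup [set ((#|[set U in simp | `[< in_img simp f U z >]]%SET|)%:R : R) | z in [set: 'rV[R]_q]].

Definition sTO (R : realType) (n : nat) (simp : {set {set 'I_n}}) (q : nat) : R :=
  inf [set sOv simp f | f in [set f | @fcont R n simp q f]].

Definition embeds (n : nat) (simpZ : {set {set 'I_n}}) (S : choiceType)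
  (simpX : set {fset S}) : Prop :=
  exists phi : 'I_n -> S, injective phi /\
    forall U, U \in simpZ -> simpX [fset phi i | i in U]%fset.

Definition sTOX (R : realType) (S : choiceType) (simpX : set {fset S}) (q r : nat) : R :=
  sup [set t | exists (n : nat) (simpZ : {set {set 'I_n}}),
     fasc simpZ /\ (n <= r)%N /\ embeds simpZ simpX /\ t = @sTO R n simpZ q].

(* Main.v *)
Require Import Defs.
From HB Require Import structures.
From mathcomp Require Import all_boot all_order all_algebra.
From mathcomp Require Import finmap.
From mathcomp Require Import all_classical all_reals all_analysis.
From mathcomp Require Import ring lra.
Import Order.TTheory GRing.Theory Num.Theory.
Import numFieldNormedType.Exports.
Set Implicit Arguments.
Unset Strict Implicit.
Unset Printing Implicit Defensive.
Local Open Scope classical_set_scope.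
Local Open Scope ring_scope.

(* Extend phi over the simplices of a finite complex Z <= X of dimension at most d,
   one skeleton at a time: the boundary of a simplex of dimension k <= d is a
   (k-1)-sphere whose image in Y has bounded diameter, so uniform k-connectedness
   fills it with bounded diameter.  The result is a continuous F : Z -> Y moving
   points a bounded distance away from phi of the nearby vertices.  As Y has
   bounded degree, F(Z) lies in a full subcomplex Z' of Y on at most C|Z|
   vertices, and since moreover phi has bounded fibres, a simplex of Z' meets
   F(U) for a bounded number of simplices U of Z.  Hence composing with F a map
   Z' -> R^q multiplies the overlap by at most a constant. *)

(** * Chains of points and the metric [cdist] *)

Section Chains.
Variables (R : realType) (S : choiceType) (simp : set {fset S}).
Implicit Types f g h : S -> R.

(** Inductive counterpart of [is_chain] that carries its length, so that estimates along a chain go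
    by induction rather than through indices of a sequence. *)
Inductive chain : (S -> R) -> (S -> R) -> R -> Prop :=
| chain_refl f : realpt simp f -> chain f f 0
| chain_step f g h l : realpt simp f -> adj simp f g -> chain g h l ->
    chain f h (l2dist f g + l).

Lemma chain_realpt f g l : chain f g l -> realpt simp f /\ realpt simp g.
Proof. by elim=> // {}f g' h l' rf _ _ [_ rh]. Qed.

Lemma chain_len_cons f g c :
  chain_len (f :: g :: c) = l2dist f g + chain_len (g :: c).
Proof. by rewrite /chain_len /= big_ord_recl. Qed.

Lemma chain_of_is_chain c f g : is_chain simp c f g -> chain f g (chain_len c).
Proof.
elim: c f => [|x c IH] f; first by case.
case: c IH => [|y c] IH [_] [] /= -> [].
  move=> <- [/(_ 0%N isT) /= rf _]; rewrite /chain_len big_ord0.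
  exact: chain_refl.
move=> gE [rc ac]; rewrite chain_len_cons.
apply: chain_step; [exact: (rc 0%N)|exact: (ac 0%N)|].
by apply: IH; split=> //; split=> //; split=> //; split=> i ic;
  [exact: (rc i.+1)|exact: (ac i.+1)].
Qed.

Lemma is_chain_of_chain f g l : chain f g l ->
  exists2 c, is_chain simp c f g & chain_len c = l.
Proof.
elim=> {f g l} [f rf|f g h l rf fg _ [c [c0 [cf [cl [rc ac]]]] <-]].
  exists [:: f]; last by rewrite /chain_len big_ord0.
  by split=> //; split=> //; split=> //; split=> // -[].
case: c c0 cf cl rc ac => // g' c _ /= -> cl rc ac.
exists [:: f, g & c]; last by rewrite chain_len_cons.
by split=> //; split=> //; split=> //; split=> -[].
Qed.

Lemma chain_trans f g h l l' : chain f g l -> chain g h l' -> chain f h (l + l').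
Proof.
elim=> {f g l} [f _|f f' g l rf ff' _ IH] gh; first by rewrite add0r.
by rewrite -addrA; apply: chain_step ff' (IH gh).
Qed.

Lemma cdist_lt_chain f g (e : R) : (cdist simp f g < e%:E)%E ->
  exists2 l, chain f g l & l < e.
Proof.
move=> /ereal_inf_lt [_ [c /= cfg <-]]; rewrite lte_fin => le.
by exists (chain_len c) => //; exact: chain_of_is_chain.
Qed.

Lemma chain_cdist_le f g l : chain f g l -> (cdist simp f g <= l%:E)%E.
Proof.
by move=> /is_chain_of_chain [c cfg <-]; apply: ereal_inf_lbound; exists c.
Qed.

Lemma cdist_le_chain f g (a e : R) : (cdist simp f g <= a%:E)%E -> 0 < e ->
  exists2 l, chain f g l & l < a + e.
Proof.
move=> fg e0; apply: cdist_lt_chain; apply: le_lt_trans fg _.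
by rewrite lte_fin ltrDl.
Qed.

Lemma cdist_triangle f g h (a b : R) : (cdist simp f g <= a%:E)%E ->
  (cdist simp g h <= b%:E)%E -> (cdist simp f h <= (a + b)%:E)%E.
Proof.
move=> fg gh; apply/lee_addgt0Pr => e e0.
have e20 : 0 < e / 2 by rewrite divr_gt0.
have [l fgl la] := cdist_le_chain fg e20.
have [l' ghl lb] := cdist_le_chain gh e20.
apply: le_trans (chain_cdist_le (chain_trans fgl ghl)) _.
by rewrite lee_fin; lra.
Qed.

Lemma cdist_refl_le f (a : R) : realpt simp f -> 0 <= a ->
  (cdist simp f f <= a%:E)%E.
Proof.
move=> rf a0; apply: le_trans (chain_cdist_le (chain_refl rf)) _.
by rewrite lee_fin.
Qed.

(** Bounds on single steps add up along a chain. This is applied to the coordinates and to weighted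
    averages of vertex functions. *)
Lemma lipschitz_chain (h : (S -> R) -> R) (K : R) :
  (forall f g, realpt simp f -> realpt simp g -> adj simp f g ->
     `|h f - h g| <= K * l2dist f g) ->
  forall f g l, chain f g l -> `|h f - h g| <= K * l.
Proof.
move=> hL f g l; elim=> {f g l} [f _|f g k l rf fg gk IH].
  by rewrite subrr normr0 mulr0.
apply: le_trans (ler_distD (h g) _ _) _.
by rewrite mulrDr lerD// hL//; case: (chain_realpt gk).
Qed.

(** The terms are nonnegative and vanish off [W], so the supremum over finite sets is attained at
    [W]. *)
Lemma l2dist_supp f g (W : {fset S}) :
  (forall s, s \notin W -> f s = 0 /\ g s = 0) ->
  l2dist f g = Num.sqrt (\sum_(s <- W) (f s - g s) ^+ 2).
Proof.
move=> fgW; congr Num.sqrt.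
set E := [set _ | _ in _].
have ubE : ubound E (\sum_(s <- W) (f s - g s) ^+ 2).
  move=> _ [F _ <-].
  rewrite (big_fsetID _ (mem W)) /= [X in _ + X]big1_seq ?addr0; last first.
    move=> s /andP[_]; rewrite !inE => /andP[_ /fgW[-> ->]].
    by rewrite subrr expr0n.
  rewrite [leRHS](big_fsetID _ (mem F)) /= -[leLHS]addr0 lerD//.
    rewrite (eq_fbigl _ _ (B := [fset x in W | (mem F) x]%fset))//.
    by move=> s; rewrite !inE andbC.
  by apply: sumr_ge0 => s _; exact: sqr_ge0.
apply/eqP; rewrite eq_le; apply/andP; split.
  by apply: ge_sup => //; exists (\sum_(s <- W) (f s - g s) ^+ 2), W.
by apply: ub_le_sup; [exists (\sum_(s <- W) (f s - g s) ^+ 2)|exists W].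
Qed.

Lemma adj_supp f g : adj simp f g -> exists2 W, simp W &
  forall s, s \notin W -> f s = 0 /\ g s = 0.
Proof.
move=> [W [sW fgW]]; exists W => // s sNW.
by split; apply/eqP; apply: contraNT sNW => nz; apply/fgW; [left|right].
Qed.

Lemma adj_coord_le f g s : adj simp f g -> `|f s - g s| <= l2dist f g.
Proof.
move=> /adj_supp[W _ fgW]; rewrite (l2dist_supp fgW) -sqrtr_sqr ler_sqrt.
  have [sW|/fgW[-> ->]] := boolP (s \in W).
    by rewrite (big_fsetD1 s)//= lerDl sumr_ge0// => i _; exact: sqr_ge0.
  by rewrite subrr expr0n sumr_ge0// => i _; exact: sqr_ge0.
by apply: sumr_ge0 => i _; exact: sqr_ge0.
Qed.

Lemma cdist_coord_lt f g s (e : R) : (cdist simp f g < e%:E)%E -> `|f s - g s| < e.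
Proof.
move=> /cdist_lt_chain[l fg]; apply: le_lt_trans.
rewrite -[leRHS]mul1r; apply: (@lipschitz_chain (fun f => f s)) fg => f' g' _ _ ?.
by rewrite mul1r adj_coord_le.
Qed.

End Chains.

Definition vertexpt (R : realType) (S : eqType) (u : S) : S -> R :=
  fun v => (v == u)%:R.

(** Induction on [N]: once a witness [t0] is set aside, any finite set of the remaining ones can be
    enlarged by [t0], so its size is bounded by one less. *)
Lemma fset_of_bounded (T : choiceType) (P : T -> Prop) (N : nat) :
  (forall F : {fset T}, (forall t, t \in F -> P t) -> (#|` F| <= N)%N) ->
  exists2 F : {fset T}, (#|` F| <= N)%N & forall t, P t -> t \in F.
Proof.
elim: N P => [|N IH] P hP.
  exists fset0 => [|t Pt]; first by rewrite cardfs0.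
  have := hP [fset t]%fset; rewrite cardfs1 => /(_ _)/wrap[]//.
  by move=> x; rewrite inE => /eqP ->.
have [[t0 Pt0]|nP] := pselect (exists t, P t); last first.
  by exists fset0 => [|t Pt]; [rewrite cardfs0|case: nP; exists t].
have [F FP|F cF FP] := IH (fun t => P t /\ t != t0).
  have t0F : t0 \notin F by apply/negP => /FP[_ /eqP].
  have := hP (t0 |` F)%fset; rewrite cardfsU1 t0F; apply => t.
  by rewrite !inE => /orP[/eqP->//|/FP[]].
exists (t0 |` F)%fset; last first.
  move=> t Pt; rewrite !inE; have [//|tt0] := eqVneq t t0.
  by rewrite FP.
by rewrite cardfsU1; case: (t0 \notin F) => //=; exact: leqW.
Qed.

(** * Balls in the 1-skeleton and their comparison with [cdist] *)

Section Balls.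
Variables (R : realType) (S : choiceType) (simp : set {fset S}).
Hypothesis simpP : asc simp.

(** Endpoints of walks with [m] steps. Since [[fset a; a]] is a simplex, walks may pause, so these
    are also the endpoints of walks with at most [m] steps. *)
Fixpoint gball (u : S) (m : nat) : set S :=
  if m is m'.+1 then [set v | exists2 w, gball u m' w & simp [fset w; v]%fset]
  else [set u].

Lemma simp_pair (U : {fset S}) a b : simp U -> a \in U -> b \in U -> simp [fset a; b]%fset.
Proof.
move=> sU aU bU; apply: (simpP.2 U) => // x.
by rewrite !inE => /orP[]/eqP->.
Qed.

Lemma simp_loop a : simp [fset a; a]%fset.
Proof. by apply: (@simp_pair [fset a]%fset); rewrite ?inE//; exact: simpP.1. Qed.

Lemma gballS u m v : gball u m v -> gball u m.+1 v.
Proof. by exists v => //; exact: simp_loop. Qed.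

Lemma gball_le u m m' v : (m <= m')%N -> gball u m v -> gball u m' v.
Proof.
move=> /subnK <-; elim: (m' - m)%N => // k IH umv.
by rewrite addSn; apply: gballS; exact: IH.
Qed.

Lemma gball_center u m : gball u m u.
Proof. exact: (@gball_le u 0). Qed.

(** The balls increase with the radius, so counting the radii below [M] that miss [v] gives the
    graph distance from [u] cut off at [M]. It stays finite between different components. *)
Definition trunc_dist (u : S) (M : nat) (v : S) : R :=
  \sum_(j < M) (`[< ~ gball u j v >])%:R.

Lemma trunc_dist_adj u M v w : simp [fset v; w]%fset ->
  trunc_dist u M w <= 1 + trunc_dist u M v.
Proof.
move=> vw; rewrite /trunc_dist; case: M => [|M].
  by rewrite !big_ord0 addr0.
(* Shift the index: the term [j+1] for [w] is compared with the term [j] for [v]. The first term for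
   [w] costs at most 1, and the last term for [v] is dropped. *)
rewrite big_ord_recl [X in _ <= 1 + X]big_ord_recr /=.
apply: lerD; first by case: asboolP.
apply: ler_wpDr; first by case: asboolP.
apply: ler_sum => i _; rewrite ler_nat /=.
case: asboolP => // nw; case: asboolP => // /contrapT uiv.
by case: nw; exists v.
Qed.

Lemma trunc_dist_center u M : trunc_dist u M u = 0.
Proof.
rewrite /trunc_dist big1// => i _; case: asboolP => // -[].
exact: gball_center.
Qed.

Lemma trunc_dist_lt u M v : trunc_dist u M v < M%:R -> gball u M v.
Proof.
move=> duv; apply: contrapT => nv; move: duv.
rewrite /trunc_dist (eq_bigr (fun=> 1)) ?sumr_const ?card_ord ?ltxx//.
move=> i _; case: asboolP => // /contrapT iv; case: nv.
by apply: gball_le iv; exact: ltnW.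
Qed.

(** The average of [rho] with weights [f]. The support is selected by choice, since points carry it
    only existentially; [weightedE] replaces it by any finite set containing it. *)
Definition weighted (rho : S -> R) (f : S -> R) : R :=
  let U := xget fset0 [set U : {fset S} | supp_is f U] in \sum_(s <- U) f s * rho s.

Lemma sum_supp (f g : S -> R) (U W : {fset S}) : supp_is f U ->
  (forall s, s \notin W -> f s = 0) ->
  \sum_(s <- U) f s * g s = \sum_(s <- W) f s * g s.
Proof.
move=> fU fW; apply: big_fset_incl.
  apply/fsubsetP => s /fU fs; apply: contraNT fs => /fW ->; exact: eqxx.
move=> s _; have [-> _|/fU ->//] := eqVneq (f s) 0.
by rewrite mul0r.
Qed.

Lemma weightedE rho f (W : {fset S}) : realpt simp f -> (forall s, s \notin W -> f s = 0) ->
  weighted rho f = \sum_(s <- W) f s * rho s.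
Proof.
move=> [_ [U [_ [fU _]]]] fW; rewrite /weighted /=.
by case: xgetP => [V _ fV|/(_ U)[]//]; exact: sum_supp.
Qed.

Lemma realpt_sum (f : S -> R) (W : {fset S}) :
  realpt simp f -> (forall s, s \notin W -> f s = 0) -> \sum_(s <- W) f s = 1.
Proof.
move=> [_ [U [_ [fU <-]]]] fW.
have := sum_supp (fun=> 1) fU fW; under eq_bigr do rewrite mulr1.
by under [in RHS]eq_bigr do rewrite mulr1.
Qed.

Lemma fset_nonempty_of_sum (f : S -> R) (W : {fset S}) :
  \sum_(s <- W) f s = 1 -> exists s, s \in W.
Proof.
case: (fset_0Vmem W) => [->|[s sW] _]; last by exists s.
by rewrite big_seq_fset0 => /eqP; rewrite eq_sym oner_eq0.
Qed.

(* Since the weights of f and g both sum to 1, rho may be shifted to vanish at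
   one vertex of the common simplex. *)
Lemma weighted_lipschitz (rho : S -> R) (K : nat) :
  (forall v w, simp [fset v; w]%fset -> rho w <= 1 + rho v) ->
  (forall U, simp U -> (#|` U| <= K)%N) ->
  forall f g, realpt simp f -> realpt simp g -> adj simp f g ->
     `|weighted rho f - weighted rho g| <= K%:R * l2dist f g.
Proof.
move=> rhoL cK f g rf rg fg; have [W sW fgW] := adj_supp fg.
have fW s : s \notin W -> f s = 0 by move/fgW => [].
have gW s : s \notin W -> g s = 0 by move/fgW => [].
rewrite (weightedE _ rf fW) (weightedE _ rg gW).
have fW1 := realpt_sum rf fW; have gW1 := realpt_sum rg gW.
have [s0 s0W] := fset_nonempty_of_sum fW1.
have -> : \sum_(s <- W) f s * rho s - \sum_(s <- W) g s * rho s =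
   \sum_(s <- W) (f s - g s) * (rho s - rho s0).
  rewrite [RHS](eq_bigr (fun s => (f s * rho s - g s * rho s) +
     - (f s - g s) * rho s0)); last by move=> s _; ring.
  rewrite big_split /= -mulr_suml !sumrB sumrN sumrB fW1 gW1.
  by ring.
apply: le_trans (ler_norm_sum _ _ _) _.
apply: (@le_trans _ _ (\sum_(s <- W) l2dist f g)).
  rewrite !big_seq; apply: ler_sum => s sWs; rewrite normrM -[leRHS]mulr1.
  apply: ler_pM => //; first exact: (adj_coord_le _ fg).
  have := rhoL _ _ (simp_pair sW sWs s0W); have := rhoL _ _ (simp_pair sW s0W sWs).
  by rewrite ler_norml; lra.
rewrite big_const_seq count_predT iter_addr addr0 -[leLHS]mulr_natl.
by rewrite ler_wpM2r ?sqrtr_ge0// ler_nat cK.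
Qed.

(* A chain of length l changes the averaged truncated distance from u by at most
   K * l, and on a simplex that average is within 1 of each vertex value. *)
Lemma cdist_gball (K : nat) (D : R) :
  (forall U, simp U -> (#|` U| <= K)%N) ->
  exists M : nat, forall f g u v, realpt simp f -> realpt simp g ->
    (cdist simp f g <= D%:E)%E -> f u != 0 -> g v != 0 -> gball u M v.
Proof.
(* One unit pays for comparing the average at [f] with the value at [u], one for [g] and [v], and
   [K * (D + 1)] for a chain of length below [D + 1]. *)
move=> cK; pose M := (Num.trunc (2 + K%:R * (D + 1) : R)).+1; exists M.
have MD : 2 + K%:R * (D + 1) < M%:R :> R by exact: truncnS_gt.
move=> f g u v rf rg fg fu gv.
apply: trunc_dist_lt; apply: le_lt_trans MD.
have [l fgl lD] := cdist_le_chain fg ltr01.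
have rhoL := @trunc_dist_adj u M.
set rho := trunc_dist u M in rhoL *.
have := lipschitz_chain (weighted_lipschitz rhoL cK) fgl.
case: (rf) => [f01 [U [sU [fU fU1]]]]; case: (rg) => [g01 [V [sV [gV gV1]]]].
have fU0 s : s \notin U -> f s = 0.
  by move=> sU0; apply/eqP; apply: contraNT sU0 => /fU.
have gV0 s : s \notin V -> g s = 0.
  by move=> sV0; apply/eqP; apply: contraNT sV0 => /gV.
rewrite (weightedE _ rf fU0) (weightedE _ rg gV0).
have hf : \sum_(s <- U) f s * rho s <= 1.
  rewrite -[leRHS]fU1 !big_seq; apply: ler_sum => s sUs.
  rewrite -[leRHS]mulr1 ler_wpM2l//; first by case/andP: (f01 s).
  have := rhoL _ _ (simp_pair sU (proj1 (fU u) fu) sUs).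
  by rewrite /rho trunc_dist_center addr0.
have hg : rho v - 1 <= \sum_(s <- V) g s * rho s.
  rewrite -[leLHS]mul1r -[X in X * _ <= _]gV1 mulr_suml !big_seq; apply: ler_sum => s sVs.
  rewrite ler_wpM2l//; first by case/andP: (g01 s).
  have := rhoL _ _ (simp_pair sV sVs (proj1 (gV v) gv)). lra.
have : K%:R * l <= K%:R * (D + 1) by rewrite ler_wpM2l// ltW.
by rewrite ler_norml; lra.
Qed.

End Balls.

(** * Uniform finiteness from bounded degree *)

Section BoundedDegree.
Variables (S : countType) (simp : set {fset S}).
Hypotheses (simpP : asc simp) (degP : bounded_degree simp).

(** All vertices of a simplex other than a chosen [s] are neighbours of [s]. *)
Lemma bounded_degree_dim : exists K : nat, forall U, simp U -> (#|` U| <= K)%N.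
Proof.
case: degP => D hD; exists D.+1 => U sU.
have [->|[s sUs]] := fset_0Vmem U; first by rewrite cardfs0.
rewrite (cardfsD1 s) sUs ltnS; apply: (hD s) => t; rewrite !inE => /andP[ts tU].
by split=> //; exact: (simp_pair simpP sU).
Qed.

(** Each step replaces a vertex by itself and its at most [D] neighbours, which multiplies the count
    by at most [D.+1]. *)
Lemma gball_finite (M : nat) : exists B : nat, forall u, exists2 L : seq S,
  (size L <= B)%N & forall v, gball simp u M v -> v \in L.
Proof.
case: degP => D hD; exists (D.+1 ^ M)%N => u.
have nbr s := fset_of_bounded (hD s).
elim: M => [|M [L sL LM]].
  by exists [:: u] => // v ->; rewrite inE.
have /choice[N NP] : forall s, exists N : {fset S}, (#|` N| <= D)%N /\
    forall t, t != s /\ simp [fset s; t]%fset -> t \in N.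
  by move=> s; have [F] := nbr s; exists F.
have cN s := proj1 (NP s); have Nn s := proj2 (NP s).
exists (flatten [seq s :: enum_fset (N s) | s <- L]).
  rewrite size_flatten /shape -map_comp.
  apply: (@leq_trans (D.+1 * size L)); last by rewrite expnS leq_mul2l sL orbT.
  by elim: (L) => //= s L' IH; rewrite mulnS leq_add// ltnS; exact: cN.
move=> v [w uw wv]; apply/flattenP; exists (w :: enum_fset (N w)).
  by apply: map_f; exact: LM.
by rewrite inE; have [//|vw] := eqVneq v w; apply: Nn.
Qed.

End BoundedDegree.

(** * Vertices as points: the path metric bounds [cdist] *)

Section Vertices.
Variables (R : realType) (S : choiceType) (simp : set {fset S}).
Hypothesis simpP : asc simp.

Lemma vertexpt_realpt u : realpt simp (vertexpt R u).
Proof.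
split=> [s|]; first by rewrite /vertexpt ler0n lern1 leq_b1.
exists [fset u]%fset; split; first exact: simpP.1.
split; last by rewrite big_seq_fset1 /vertexpt eqxx.
by move=> s; rewrite inE /vertexpt pnatr_eq0 eqb0 negbK.
Qed.

(** A one-step chain suffices: at most two coordinates differ, each by at most 1. The bound 2 is a
    convenient substitute for the square root of 2. *)
Lemma cdist_edge u v : simp [fset u; v]%fset ->
  (cdist simp (vertexpt R u) (vertexpt R v) <= 2%:E)%E.
Proof.
move=> uv.
have [ru rv] := (vertexpt_realpt u, vertexpt_realpt v).
have av : adj simp (vertexpt R u) (vertexpt R v).
  exists [fset u; v]%fset; split=> // s.
  by rewrite !inE /vertexpt !pnatr_eq0 !eqb0 !negbK; split=> /orP.
apply: le_trans (chain_cdist_le (chain_step ru av (chain_refl rv))) _.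
rewrite lee_fin addr0 (@l2dist_supp _ _ _ _ [fset u; v]%fset); last first.
  by move=> s; rewrite !inE /vertexpt negb_or => /andP[/negPf-> /negPf->].
have -> : 2 = Num.sqrt (2 ^+ 2) :> R by rewrite sqrtr_sqr ger0_norm.
rewrite ler_sqrt ?exprn_ge0//.
apply: (@le_trans _ _ (\sum_(s <- [fset u; v]%fset) 1)).
  apply: ler_sum => s _; rewrite /vertexpt.
  by case: (s == u); case: (s == v); rewrite ?subrr ?subr0 ?sub0r ?sqrrN ?expr1n ?expr0n.
rewrite big_const_seq count_predT iter_addr addr0 expr2 -[2 * 2]natrM ler_nat.
by rewrite cardfs2; case: eqP.
Qed.

Lemma epath_cdist u v m : epath simp u v m ->
  (cdist simp (vertexpt R u) (vertexpt R v) <= (2 * m%:R)%:E)%E.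
Proof.
move=> [c [_ [c0 [cm cS]]]]; rewrite -cm.
have : (m <= m)%N by [].
elim: {-2}m => [_|k IH km].
  by rewrite c0 mulr0; apply: cdist_refl_le => //; exact: vertexpt_realpt.
rewrite -[k.+1%:R]natr1 mulrDr mulr1; apply: cdist_triangle (IH (ltnW km)) _.
by apply: cdist_edge; exact: cS.
Qed.

Lemma gdist_cdist u v (L : R) : (gdist R simp u v <= L%:E)%E ->
  (cdist simp (vertexpt R u) (vertexpt R v) <= (2 * (L + 1))%:E)%E.
Proof.
move=> uvL.
(* The slack 1 turns the infimum into an actual edge path with fewer than [L + 1] edges. *)
have : (gdist R simp u v < (L + 1)%:E)%E.
  by apply: le_lt_trans uvL _; rewrite lte_fin ltrDl.
move=> /ereal_inf_lt[_ [m /= uvm <-]]; rewrite lte_fin => mL.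
apply: le_trans (epath_cdist uvm) _; rewrite lee_fin.
by rewrite ler_wpM2l// ltW.
Qed.

Lemma gdist_edge u v : simp [fset u; v]%fset -> (gdist R simp u v <= 1%:E)%E.
Proof.
move=> uv; apply: ereal_inf_lbound; exists 1%N => //=.
by exists [:: u; v]; do !split => //; case.
Qed.

End Vertices.

(** * Limits in coordinates *)

Section CoordinateFilter.
Variables (R : realType) (J : Type).

(** Unfolds to the [del] condition of [fcont], while being a filter to which the general rules for
    limits apply. *)
Definition cnbhs (x : J -> R) : set_system (J -> R) :=
  [set P | exists2 del : R, 0 < del & forall y, (forall j, `|x j - y j| < del) -> P y].

Global Instance cnbhs_filter x : Filter (cnbhs x).
Proof.
split.
- by exists 1 => //; exact: ltr01.
- move=> P Q [d d0 dP] [e e0 eQ]; exists (Num.min d e).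
    by rewrite lt_min d0.
  by move=> y xy; split; [apply: dP|apply: eQ] => j; have := xy j;
    rewrite lt_min => /andP[].
- by move=> P Q PQ [d d0 dP]; exists d => // y /dP/PQ.
Qed.

Lemma coord_cvg x j : y j @[y --> cnbhs x] --> x j.
Proof. by apply/cvgrPdist_lt => e e0; exists e => // y; apply. Qed.

End CoordinateFilter.

Lemma sum_cvg (R : realType) (T I : Type) (F : set_system T) (FF : Filter F)
    (r : seq I) (P : pred I) (h : I -> T -> R) (c : I -> R) :
  (forall i, P i -> h i t @[t --> F] --> c i) ->
  \sum_(i <- r | P i) h i t @[t --> F] --> \sum_(i <- r | P i) c i.
Proof. by move=> hc; apply: cvg_big => // -[a b]; exact: add_continuous. Qed.

(** * The Euclidean norm *)

Section Enorm.
Variables (R : realType) (k : nat).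
Implicit Types v w : 'rV[R]_k.

Lemma enorm_ge0 v : 0 <= enorm v. Proof. exact: sqrtr_ge0. Qed.

Lemma enorm_coord_le v j : `|v ord0 j| <= enorm v.
Proof.
rewrite -sqrtr_sqr /enorm ler_sqrt; last by apply: sumr_ge0 => i _; exact: sqr_ge0.
by rewrite (bigD1 j)//= lerDl sumr_ge0// => i _; exact: sqr_ge0.
Qed.

Lemma enormZ c v : enorm (c *: v) = `|c| * enorm v.
Proof.
rewrite /enorm -sqrtr_sqr -sqrtrM ?sqr_ge0// mulr_sumr; congr Num.sqrt.
by apply: eq_bigr => i _; rewrite mxE exprMn.
Qed.

Lemma enorm0 : enorm (0 : 'rV[R]_k) = 0.
Proof. by rewrite -(scale0r 0) enormZ normr0 mul0r. Qed.

Lemma enorm_cvg (T : Type) (F : set_system T) (FF : Filter F) (h : T -> 'rV[R]_k) v :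
  (forall j, h t ord0 j @[t --> F] --> v ord0 j) -> enorm (h t) @[t --> F] --> enorm v.
Proof.
move=> hv; apply: (@continuous_cvg _ _ _ F FF _ Num.sqrt).
  exact: sqrt_continuous.
by apply: sum_cvg => i _; under eq_cvg do rewrite expr2; rewrite expr2; exact: cvgM.
Qed.

End Enorm.

(** * The least coordinate over a set of vertices *)

Section SetMin.
Variables (R : realType) (n : nat) (U : {set 'I_n}) (u0 : 'I_n).
Hypothesis u0U : u0 \in U.
Implicit Types y : 'I_n -> R.

Definition setmin y : R := y [arg min_(i < u0 in U) y i]%O.

Lemma setminP y : exists2 l, l \in U & setmin y = y l /\ forall i, i \in U -> y l <= y i.
Proof. by rewrite /setmin; case: arg_minP => // l lU lmin; exists l. Qed.

Lemma setmin_le y i : i \in U -> setmin y <= y i.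
Proof. by move=> iU; have [l _ [-> /(_ i iU)]] := setminP y. Qed.

Lemma setmin_eq y l : l \in U -> (forall i, i \in U -> y l <= y i) -> setmin y = y l.
Proof.
move=> lU lmin; apply/eqP; rewrite eq_le setmin_le//=.
by have [l' /lmin ? [-> _]] := setminP y.
Qed.

Lemma setmin_cvg (T : Type) (F : set_system T) (FF : Filter F) (h : T -> 'I_n -> R) c :
  (forall i, h t i @[t --> F] --> c i) -> setmin (h t) @[t --> F] --> setmin c.
Proof.
move=> hc; apply/cvgrPdist_lt => e e0.
have : \forall t \near F, forall i, `|c i - h t i| < e.
  by apply: filter_forall => i; move/cvgrPdist_lt: (hc i); exact.
apply: filterS => t ct.
(* Testing the minimiser of each point in the other one bounds the difference of the minima from
   both sides. *)
have [l lU [ml minl]] := setminP c; have [l' l'U [ml' minl']] := setminP (h t).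
have := ct l; have := ct l'; have := minl _ l'U; have := minl' _ lU.
by rewrite ml ml' !ltr_norml => ? ? /andP[? ?] /andP[? ?]; apply/andP; split; lra.
Qed.

End SetMin.

(** * Closed simplices and their passage to disks *)

Definition clos (R : realType) (n : nat) (U : {set 'I_n}) : set ('I_n -> R) :=
  [set x | [/\ forall i, 0 <= x i, \sum_i x i = 1 & forall i, i \notin U -> x i = 0]].

Lemma closS (R : realType) (n : nat) (A B : {set 'I_n}) (x : 'I_n -> R) :
  A \subset B -> clos A x -> clos B x.
Proof.
move=> /fintype.subsetP AB [x0 x1 xA]; split=> // i iB.
by apply: xA; apply: contraNN iB => /AB.
Qed.

(* bmap = vmap / (|vmap| + min x) maps the simplex U to the unit disk and its
   boundary to the sphere.  On rays amap inverts it: a boundary point is recovered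
   from (x_i - x_u0)_i by subtracting the minimum and normalising the sum. *)
Section SimplexDisk.
Variables (R : realType) (n : nat) (U : {set 'I_n}) (u0 : 'I_n).
Hypothesis u0U : u0 \in U.
Local Notation k := #|U :\ u0|.
Local Notation mn := (@setmin R n U u0).

(** Vectors are indexed by [U :\ u0] through [enum_val]; this rewrites them as functions of the
    vertex, with value 0 at [u0]. *)
Definition wext (w : 'rV[R]_k) (i : 'I_n) : R :=
  \sum_(j < k) (enum_val j == i)%:R * w ord0 j.

Lemma wext_val w j : wext w (enum_val j) = w ord0 j.
Proof.
rewrite /wext (bigD1 j)//= eqxx mul1r big1 ?addr0// => i ij.
by rewrite (inj_eq enum_val_inj) (negPf ij) mul0r.
Qed.

Lemma wext_u0 w : wext w u0 = 0.
Proof.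
rewrite /wext big1// => j _; case: eqP => [ju|]; last by rewrite mul0r.
by have := enum_valP j; rewrite ju !inE eqxx.
Qed.

Lemma wextZ c w i : wext (c *: w) i = c * wext w i.
Proof. by rewrite /wext mulr_sumr; apply: eq_bigr => j _; rewrite mxE mulrCA. Qed.

Lemma val_cases i : i \in U -> i = u0 \/ exists j : 'I_k, i = enum_val j.
Proof.
move=> iU; have [->|iu] := eqVneq i u0; first by left.
have iU' : i \in U :\ u0 by rewrite !inE iu.
by right; exists (enum_rank_in iU' i); rewrite enum_rankK_in.
Qed.

Definition aden (w : 'rV[R]_k) : R := \sum_(l in U) (wext w l - mn (wext w)).

Definition amap (w : 'rV[R]_k) (i : 'I_n) : R :=
  (i \in U)%:R * ((wext w i - mn (wext w)) / aden w).

(** A vanishing sum of nonnegative terms would make [wext w] constant on [U], hence 0 as at [u0],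
    against the nonzero coordinate. *)
Lemma aden_gt0 (w : 'rV[R]_k) : (exists j, w ord0 j != 0) -> 0 < aden w.
Proof.
move=> [j wj]; have ge0 l : l \in U -> 0 <= wext w l - mn (wext w).
  by move=> lU; rewrite subr_ge0 setmin_le.
rewrite lt_neqAle sumr_ge0// andbT eq_sym; apply: contraNN wj => /eqP a0.
have E l : l \in U -> wext w l = mn (wext w).
  by move=> lU; apply/eqP; rewrite -subr_eq0; apply/eqP; apply: (psumr_eq0P ge0).
have jU : enum_val j \in U by have := enum_valP j; rewrite inE => /andP[].
by rewrite -(wext_val w) (E _ jU) -(E u0)// wext_u0.
Qed.

(** A vertex where [wext w] is least receives coordinate 0, so the image lies in the opposite
    face. *)
Lemma amap_clos (w : 'rV[R]_k) : (exists j, w ord0 j != 0) ->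
  exists2 i, i \in U & clos (U :\ i) (amap w).
Proof.
move=> wn0; have a0 := aden_gt0 wn0.
have [l lU [ml _]] := setminP u0U (wext w).
exists l => //; split.
- move=> i; rewrite /amap; case: (boolP (i \in U)) => iU; last by rewrite mul0r.
  by rewrite mul1r divr_ge0 ?subr_ge0 ?setmin_le// ltW.
- rewrite (bigID (mem U))/= [X in _ + X]big1 => [|i /negPf iU]; last first.
    by rewrite /amap iU mul0r.
  rewrite addr0 (eq_bigr (fun i => (wext w i - mn (wext w)) / aden w)).
    by rewrite -mulr_suml divff// gt_eqF.
  by move=> i iU; rewrite /amap iU mul1r.
- move=> i; rewrite !inE negb_and negbK /amap => /orP[/eqP->|/negPf->].
    by rewrite ml subrr mul0r mulr0.
  by rewrite mul0r.
Qed.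

Lemma amap_cvg (w : 'rV[R]_k) : (exists j, w ord0 j != 0) ->
  forall (F : set_system 'rV[R]_k) (FF : Filter F),
  (forall j, w' ord0 j @[w' --> F] --> w ord0 j) ->
  forall i, amap w' i @[w' --> F] --> amap w i.
Proof.
move=> wn0 F FF Fw i.
have ext_cvg l : wext w' l @[w' --> F] --> wext w l.
  by apply: sum_cvg => j _; exact: cvgM (cvg_cst _) (Fw j).
have mn_cvg : mn (wext w') @[w' --> F] --> mn (wext w) by exact: setmin_cvg.
have sub_cvg l : wext w' l - mn (wext w') @[w' --> F] --> wext w l - mn (wext w).
  exact: cvgB.
apply: cvgM (cvg_cst _) _; apply: cvgM (sub_cvg i) _.
by apply: cvgV; [rewrite gt_eqF// aden_gt0|exact: sum_cvg].
Qed.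

Definition vmap (x : 'I_n -> R) : 'rV[R]_k := \row_j (x (enum_val j) - x u0).

Lemma vmapE x j : vmap x ord0 j = x (enum_val j) - x u0.
Proof. by rewrite mxE. Qed.

Definition bden (x : 'I_n -> R) : R := enorm (vmap x) + mn x.
Definition bmap (x : 'I_n -> R) : 'rV[R]_k := (bden x)^-1 *: vmap x.

Lemma clos_mn_ge0 x : clos U x -> 0 <= mn x.
Proof. by case=> x0 _ _; have [l _ [-> _]] := setminP u0U x. Qed.

(** If both summands vanished, all coordinates on [U] would agree and their minimum would be 0,
    contradicting total weight 1. *)
Lemma bden_gt0 x : clos U x -> 0 < bden x.
Proof.
move=> xU; have m0 := clos_mn_ge0 xU; have e0 := enorm_ge0 (vmap x).
rewrite lt_neqAle addr_ge0// andbT eq_sym paddr_eq0//.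
apply/negP => /andP[/eqP v0 /eqP mx0].
have E i : i \in U -> x i = x u0.
  move=> /val_cases[->//|[j ->]]; apply/eqP; rewrite -subr_eq0 -normr_le0 -v0.
  by have := enorm_coord_le (vmap x) j; rewrite mxE.
have x00 : x u0 = 0.
  by have [l lU [ml _]] := setminP u0U x; rewrite -(E l lU) -ml.
case: xU => _ + xN; rewrite big1 => [/eqP|i _]; first by rewrite eq_sym oner_eq0.
by have [/E->|/xN] := boolP (i \in U).
Qed.

Lemma bmap_disk x : clos U x -> disk (bmap x).
Proof.
move=> xU; have b0 := bden_gt0 xU.
rewrite /disk /= /bmap enormZ ger0_norm ?invr_ge0 ?(ltW b0)//.
by rewrite mulrC ler_pdivrMr// mul1r lerDl clos_mn_ge0.
Qed.

Lemma bmap_bdry x i : i \in U -> clos (U :\ i) x ->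
  sphere (bmap x) /\ amap (bmap x) = x.
Proof.
move=> iU xUi; have xU : clos U x by apply: closS xUi; exact: subsetDl.
have [x0 x1 xN] := xUi.
have xi0 : x i = 0 by rewrite xN// !inE eqxx.
have m0 : mn x = 0 by rewrite (setmin_eq u0U iU)// => l _; rewrite xi0.
have b0 := bden_gt0 xU.
split.
  rewrite /sphere /= /bmap enormZ ger0_norm ?invr_ge0 ?(ltW b0)//.
  by rewrite /bden m0 addr0 mulVf//; move: b0; rewrite /bden m0 addr0 => /gt_eqF ->.
set c := (bden x)^-1; have c0 : 0 < c by rewrite invr_gt0.
have E l : l \in U -> wext (bmap x) l = c * (x l - x u0).
  move=> /val_cases[->|[j ->]]; first by rewrite wext_u0 subrr mulr0.
  by rewrite wextZ wext_val mxE.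
(* The minimum sits at [i], where [x] vanishes; subtracting it leaves [c * x], whose sum is [c]. *)
have M : mn (wext (bmap x)) = c * (x i - x u0).
  rewrite (setmin_eq u0U iU) ?E// => l lU; rewrite !E//.
  by rewrite ler_wpM2l ?(ltW c0)// lerB// xi0.
have E' l : l \in U -> wext (bmap x) l - mn (wext (bmap x)) = c * x l.
  by move=> lU; rewrite E// M xi0; ring.
have AE : aden (bmap x) = c.
  rewrite /aden (eq_bigr (fun l => c * x l))// -mulr_sumr -[RHS]mulr1 -x1; congr *%R.
  rewrite [RHS](bigID (mem U))/= [X in _ + X]big1 ?addr0// => l lU.
  by case: xU => _ _ ->.
apply/funext => l; rewrite /amap AE; have [lU|lU] := boolP (l \in U).
  by rewrite E'// mul1r mulrAC divff ?mul1r// gt_eqF.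
by rewrite mul0r; case: xU => _ _ ->.
Qed.

Lemma bmap_cvg x : clos U x -> enorm (bmap x - bmap y) @[y --> cnbhs x] --> 0.
Proof.
move=> xU; rewrite -(enorm0 R k) -(subrr (bmap x)).
apply: enorm_cvg => j.
have v_cvg i : vmap y ord0 i @[y --> cnbhs x] --> vmap x ord0 i.
  under eq_cvg do rewrite vmapE.
  by rewrite vmapE; apply: cvgB; [exact: coord_cvg|exact: (@coord_cvg _ _ x u0)].
have b_cvg : bden y @[y --> cnbhs x] --> bden x.
  apply: cvgD; first exact: enorm_cvg v_cvg.
  by apply: (@setmin_cvg _ _ _ _ u0U _ (cnbhs x) _ id) => i; exact: coord_cvg.
have bE y : (bmap x - bmap y) ord0 j = bmap x ord0 j - (bden y)^-1 * vmap y ord0 j.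
  by rewrite !mxE.
under eq_cvg do rewrite bE.
rewrite bE; apply: cvgB (cvg_cst _) _; apply: cvgM (v_cvg j).
by apply: cvgV => //; rewrite gt_eqF// bden_gt0.
Qed.

End SimplexDisk.

(** * Extension of vertex maps, skeleton by skeleton *)

Section Extension.
Variables (R : realType) (S : choiceType) (simp : set {fset S}).
Hypothesis simpP : asc simp.

Definition cont_on (n : nat) (A : set ('I_n -> R)) (F : ('I_n -> R) -> S -> R) :=
  forall x, A x -> forall e : R, 0 < e ->
    \forall y \near cnbhs x, A y -> (cdist simp (F x) (F y) < e%:E)%E.

(** There are finitely many closed simplices. If [x] is not in [clos V], some [x i] with [i] outside
    [V] is nonzero, and points within [|x i|] of [x] avoid [clos V]. *)
Lemma cont_on_pasting n (T : {set {set 'I_n}}) (F : ('I_n -> R) -> S -> R) :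
  (forall U, U \in T -> cont_on (clos U) F) ->
  cont_on [set x | exists2 U, U \in T & clos U x] F.
Proof.
move=> FT x [U UT xU] e e0.
suff : \forall y \near cnbhs x, forall V : {set 'I_n}, V \in T -> clos V y ->
    (cdist simp (F x) (F y) < e%:E)%E.
  by apply: filterS => y yV [V VT Vy]; exact: yV Vy.
apply: filter_forall => V; have [VT|_] := boolP (V \in T); last first.
  by near=> y.
have [xV|xV] := pselect (clos V x).
  by have := FT V VT x xV e e0; apply: filterS => y yV _; exact: yV.
have [i iV xi] : exists2 i, i \notin V & x i != 0.
  apply: contrapT => nx; apply: xV; case: xU => x0 x1 _; split=> // i iV.
  by apply/eqP; apply/negP => /negP xi; apply: nx; exists i.
exists `|x i|; first by rewrite normr_gt0.
move=> y xy _ [_ _ /(_ _ iV) yi]; have := xy i.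
by rewrite yi subr0 ltxx.
Unshelve. all: by end_near. Qed.

(** The boundary map is carried to the sphere by [amap], filled over the disk, and pulled back by
    [bmap]. The filling hypothesis is spelled out for a fixed pair [s], [S'] in dimension
    [#|U :\ u0|], which the caller rewrites to its own index. *)
Lemma simplex_filling n (U : {set 'I_n}) (u0 : 'I_n) (s S' : R)
    (F : ('I_n -> R) -> S -> R) :
  u0 \in U ->
  (forall f : 'rV[R]_#|U :\ u0| -> S -> R,
    (forall x, sphere x -> realpt simp (f x)) ->
    cont_into simp (@sphere R _) f ->
    (cdiam simp (@sphere R _) f <= s%:E)%E ->
    exists g : 'rV[R]_#|U :\ u0| -> S -> R,
      (forall x, disk x -> realpt simp (g x)) /\
      cont_into simp (@disk R _) g /\
      (forall x, sphere x -> g x = f x) /\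
      (cdiam simp (@disk R _) g <= S'%:E)%E) ->
  (forall i x, i \in U -> clos (U :\ i) x -> realpt simp (F x)) ->
  (forall i, i \in U -> cont_on (clos (U :\ i)) F) ->
  (forall i j x y, i \in U -> j \in U -> clos (U :\ i) x -> clos (U :\ j) y ->
    (cdist simp (F x) (F y) <= s%:E)%E) ->
  exists G : ('I_n -> R) -> S -> R,
    [/\ forall x, clos U x -> realpt simp (G x),
        cont_on (clos U) G,
        forall x y, clos U x -> clos U y -> (cdist simp (G x) (G y) <= S'%:E)%E &
        forall i x, i \in U -> clos (U :\ i) x -> G x = F x].
Proof.
move=> u0U conn rF cF dF.
set k := #|U :\ u0| in conn.
have sn0 (w : 'rV[R]_k) : sphere w -> exists j, w ord0 j != 0.
  move=> ws; apply: contrapT => nw; have w0 : w = 0.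
    apply/rowP => j; rewrite mxE; apply/eqP/negP => /negP wj.
    by apply: nw; exists j.
  by move: ws; rewrite /sphere /= w0 enorm0 => /eqP; rewrite eq_sym oner_eq0.
have aU w (ws : sphere w) := amap_clos u0U (sn0 w ws).
have [|||g [rg [cg [gf dg]]]] := conn (fun w => F (amap w)).
- by move=> w ws; have [i iU wi] := aU w ws; exact: rF wi.
- have cbd : cont_on [set x | exists2 V, V \in [set U :\ i | i in U]%SET & clos V x] F.
    by apply: cont_on_pasting => _ /imsetP[i iU ->]; exact: cF.
  have bd (w : 'rV[R]_k) : sphere w ->
      exists2 V, V \in [set U :\ i | i in U]%SET & clos V (amap w).
    by move=> ws; have [i iU wi] := aU w ws; exists (U :\ i) => //; exact: imset_f.
  move=> w ws e e0; have := cbd _ (bd _ ws) e e0; case=> del del0 Hdel.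
  (* The filter of Euclidean neighbourhoods of [w], through which [amap_cvg] meets the definition of
     [cont_into]. *)
  pose N : set_system 'rV[R]_k := [set P | exists2 d : R, 0 < d &
     forall w', enorm (w - w') < d -> P w'].
  have NF : Filter N.
    split; first by exists 1 => //; exact: ltr01.
    - move=> P Q [d d0 dP] [e' e'0 eQ]; exists (Num.min d e').
        by rewrite lt_min d0.
      by move=> w'; rewrite lt_min => /andP[? ?]; split; [exact: dP|exact: eQ].
    - by move=> P Q PQ [d d0 dP]; exists d => // w' /dP/PQ.
  have Nw j : w' ord0 j @[w' --> N] --> w ord0 j.
    apply/cvgrPdist_lt => e' e'0; exists e' => // w'; apply: le_lt_trans.
    by have := enorm_coord_le (w - w') j; rewrite !mxE.
  have : \forall w' \near N, forall i, `|amap w i - amap w' i| < del.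
    apply: filter_forall => i.
    by move/cvgrPdist_lt: (amap_cvg u0U (sn0 _ ws) NF Nw (i := i)); exact.
  case=> d d0 Hd; exists d => // w' ws' ww'.
  by apply: Hdel; [exact: Hd|exact: bd].
- apply: ub_ereal_sup => _ [x [y [xs [ys ->]]]].
  have [i iU xi] := aU _ xs; have [j jU yj] := aU _ ys.
  exact: dF xi yj.
exists (fun x => g (bmap U u0 x)); split.
- by move=> x xU; apply: rg; exact: bmap_disk.
- move=> x xU e e0; have [d d0 Hd] := cg _ (bmap_disk u0U xU) e e0.
  have /cvgrPdist_lt/(_ d d0) := bmap_cvg u0U xU.
  apply: filterS => y; rewrite sub0r normrN ger0_norm ?enorm_ge0// => xy yU.
  by apply: Hd => //; exact: bmap_disk.
- move=> x y xU yU; apply: le_trans dg; apply: ereal_sup_ubound.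
  exists (bmap U u0 x), (bmap U u0 y); split; first exact: bmap_disk.
  by split; first exact: bmap_disk.
- move=> i x iU xi; have [bs ab] := bmap_bdry u0U iU xi.
  by rewrite gf// ab.
Qed.

Definition extends_over (n : nat) (Z : {set {set 'I_n}}) (psi : 'I_n -> S) (D : R)
    (F : ('I_n -> R) -> S -> R) :=
  forall U, U \in Z ->
    [/\ forall x, clos U x -> realpt simp (F x),
        cont_on (clos U) F,
        forall x y, clos U x -> clos U y -> (cdist simp (F x) (F y) <= D%:E)%E &
        forall i, i \in U -> F (vertexpt R i) = vertexpt R (psi i)].

Lemma vertexpt_clos n (U : {set 'I_n}) i : i \in U -> clos U (vertexpt R i).
Proof.
move=> iU; split.
- by move=> j; exact: ler0n.
- rewrite (bigD1 i)//= /vertexpt eqxx big1 ?addr0// => j /negPf ->.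
  by [].
- move=> j jU; rewrite /vertexpt; case: eqP => // ji.
  by move: jU; rewrite ji iU.
Qed.

Lemma clos1 n (i : 'I_n) x : clos [set i]%SET x -> x = vertexpt R i.
Proof.
move=> [_ x1 xN]; apply/funext => j; rewrite /vertexpt; case: eqP => [->|/eqP ji].
  rewrite -x1 (bigD1 i)//= big1 ?addr0// => l li.
  by rewrite xN// inE.
by rewrite xN// inE.
Qed.

Lemma clos_nonempty n (U : {set 'I_n}) (x : 'I_n -> R) : clos U x ->
  exists2 i, i \in U & x i != 0.
Proof.
move=> [_ x1 xN]; apply: contrapT => nx; move: x1; rewrite big1 => [/eqP|i _].
  by rewrite eq_sym oner_eq0.
have [iU|/xN//] := boolP (i \in U).
by apply/eqP; apply/negP => /negP xi; apply: nx; exists i.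
Qed.

Lemma extension_base n (Z : {set {set 'I_n}}) psi :
  (forall U, U \in Z -> (#|U| <= 1)%N) -> exists F, extends_over Z psi 0 F.
Proof.
(* A point of a closed simplex has a nonzero coordinate, so the default [zpt], which is not a point
   of the realisation, is never reached there. *)
move=> Z1; exists (fun x : 'I_n -> R =>
  if [pick i | x i != 0] is Some i then vertexpt R (psi i) else @zpt R S).
move=> U UZ.
have [U0|/set0Pn[i0 i0U]] := eqVneq U finset.set0.
  have N (x : 'I_n -> R) : ~ clos U x.
    by move=> /clos_nonempty[i]; rewrite U0 inE.
  by split=> // [x /N//|x /N//|x y /N//|i]; rewrite U0 inE.
have -> : U = [set i0]%SET.
  by apply/esym/eqP; rewrite eqEcard finset.sub1set i0U cards1 Z1.
have E : (if [pick i | vertexpt R i0 i != 0] is Some i then vertexpt R (psi i)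
          else @zpt R S) = vertexpt R (psi i0).
  case: pickP => [i|/(_ i0)]; last by rewrite /vertexpt eqxx oner_eq0.
  by rewrite /vertexpt; case: (eqVneq i i0) => [->//|_]; rewrite eqxx.
have rv := vertexpt_realpt R simpP (psi i0).
split.
- by move=> x /clos1 ->; rewrite E.
- move=> x /clos1 -> e e0; near=> y => /clos1 ->; rewrite E.
  by apply: le_lt_trans (cdist_refl_le rv (lexx 0)) _; rewrite lte_fin.
- by move=> x y /clos1 -> /clos1 ->; rewrite E; exact: cdist_refl_le.
- by move=> i; rewrite inE => /eqP ->.
Unshelve. all: by end_near. Qed.

(** [D] is chosen before the complex, so one bound serves all finite complexes at once. The number
    [m] counts vertices: the simplices have dimension below [m]. *)
Definition extendable (L0 : R) (m : nat) :=
  exists D : R, forall n (Z : {set {set 'I_n}}) psi,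
    (forall A B : {set 'I_n}, A \in Z -> B \subset A -> B \in Z) ->
    (forall U, U \in Z -> (#|U| <= m)%N) ->
    (forall U i j, U \in Z -> i \in U -> j \in U ->
       (cdist simp (vertexpt R (psi i)) (vertexpt R (psi j)) <= L0%:E)%E) ->
    exists F, extends_over Z psi D F.

Lemma extension_step (L0 : R) m : (0 < m)%N -> unif_connected R simp m ->
  extendable L0 m -> extendable L0 m.+1.
Proof.
move=> m0 conn [D HD].
(* Two boundary points are compared through vertices of their faces: [D] inside the first face, [L0]
   between the vertex images, [D] inside the second face. *)
pose s := D + L0 + D; have [S' HS'] := conn s.
exists (Num.max D S') => n Z psi Zdown Zm Zpsi.
pose Zm' := [set U in Z | (#|U| <= m)%N]%SET.
have [||| F HF] := HD n Zm' psi.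
- move=> A B; rewrite !inE => /andP[AZ Am] BA; rewrite (Zdown A)//=.
  by apply: leq_trans Am; exact: subset_leq_card.
- by move=> U; rewrite inE => /andP[].
- by move=> U i j; rewrite inE => /andP[UZ _]; exact: Zpsi.
(* Putting the conditions on [U] into the conclusion makes the claim total in [U], so choice yields
   one family of fillings; [zpt] fills in where the conditions fail. *)
have fill (U : {set 'I_n}) : exists G : ('I_n -> R) -> S -> R,
    U \in Z -> #|U| = m.+1 ->
    [/\ forall x, clos U x -> realpt simp (G x),
        cont_on (clos U) G,
        forall x y, clos U x -> clos U y -> (cdist simp (G x) (G y) <= S'%:E)%E &
        forall i x, i \in U -> clos (U :\ i) x -> G x = F x].
  have [UZ|] := boolP (U \in Z); last by move=> /negP ?; exists (fun=> @zpt R S).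
  have [Um|] := eqVneq #|U| m.+1; last by move=> /eqP ?; exists (fun=> @zpt R S).
  have [u0 u0U] : exists u0, u0 \in U.
    by apply/set0Pn; rewrite -card_gt0 Um.
  have cU i : i \in U -> #|U :\ i| = m.
    by move=> iU; move: Um; rewrite (cardsD1 i) iU => -[].
  have UiZ i : i \in U -> (U :\ i) \in Zm'.
    by move=> iU; rewrite inE cU// leqnn (Zdown U)// subsetDl.
  have [||||G HG] := @simplex_filling n U u0 s S' F u0U; last by exists G.
  - by rewrite (cU _ u0U).
  - by move=> i x iU; have [+ _ _ _] := HF _ (UiZ _ iU); exact.
  - by move=> i iU; have [] := HF _ (UiZ _ iU).
  - move=> i j x y iU jU xi yj.
    have [_ _ di vi] := HF _ (UiZ _ iU); have [_ _ dj vj] := HF _ (UiZ _ jU).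
    have [i' i'U _] := clos_nonempty xi; have [j' j'U _] := clos_nonempty yj.
    have i'c := vertexpt_clos i'U; have j'c := vertexpt_clos j'U.
    have i'i : i' \in U by move: i'U; rewrite !inE => /andP[].
    have j'j : j' \in U by move: j'U; rewrite !inE => /andP[].
    apply: cdist_triangle (dj _ _ j'c yj).
    apply: cdist_triangle (di _ _ xi i'c) _.
    by rewrite vi// vj//; exact: Zpsi UZ i'i j'j.
have [G HG] := choice fill.
pose supp (x : 'I_n -> R) := [set i | x i != 0]%SET.
(* A point interior to a simplex with [m.+1] vertices takes the filling of that simplex; all other
   points keep the value of [F]. *)
pose F' x := if (#|supp x| <= m)%N then F x else G (supp x) x.
have suppP U x : clos U x -> supp x \subset U.
  move=> [_ _ xN]; apply/fintype.subsetP => i; rewrite inE.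
  by apply: contraR => /xN ->.
exists F' => U UZ.
have : (#|U| <= m.+1)%N by exact: Zm.
rewrite leq_eqVlt => /orP[/eqP Um|].
  have [rG cG dG GF] := HG U UZ Um.
  have E x : clos U x -> F' x = G U x.
    move=> xU; rewrite /F'; have sU := suppP _ _ xU.
    case: leqP => sm; last first.
      by have -> : supp x = U by apply/eqP; rewrite eqEcard sU Um.
    (* A smaller support misses a vertex [i] of [U], so [x] lies on a face where the filling agrees
       with [F]. *)
    have : ~~ (U \subset supp x).
      by apply/negP => /subset_leq_card; rewrite Um leqNgt ltnS sm.
    case/subsetPn => i iU; rewrite inE negbK => /eqP xi.
    rewrite (GF i)//; case: xU => x0 x1 xN; split=> // j.
    by rewrite !inE negb_and negbK => /orP[/eqP->//|/xN].
  split.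
  - by move=> x xU; rewrite E//; exact: rG.
  - move=> x xU e e0; have := cG x xU e e0; apply: filterS => y xy yU.
    by rewrite !E//; exact: xy.
  - move=> x y xU yU; rewrite !E//; apply: le_trans (dG _ _ xU yU) _.
    by rewrite lee_fin le_max lexx orbT.
  - move=> i iU; rewrite E; last exact: vertexpt_clos.
    (* As [m] is positive there is a second vertex [j], and the vertex [i] lies on the face opposite
       to [j], where [F] is already known. *)
    have [j jU ji] : exists2 j, j \in U & j != i.
      have : (0 < #|U :\ i|)%N by move: Um; rewrite (cardsD1 i) iU add1n => -[->].
      by rewrite card_gt0 => /set0Pn[j]; rewrite !inE => /andP[? ?]; exists j.
    have iUj : i \in U :\ j by rewrite !inE eq_sym ji iU.
    rewrite (GF j)//; last exact: vertexpt_clos.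
    have UjZ : U :\ j \in Zm'.
      rewrite inE (Zdown U)// ?subsetDl//=.
      by rewrite -ltnS -Um (cardsD1 j U) jU.
    by have [_ _ _ ->] := HF _ UjZ.
rewrite ltnS => Um.
have [|rF cF dF vF] := HF U; first by rewrite inE UZ Um.
have E x : clos U x -> F' x = F x.
  move=> /suppP sU; rewrite /F' ifT//.
  by apply: leq_trans Um; exact: subset_leq_card.
split.
- by move=> x xU; rewrite E//; exact: rF.
- move=> x xU e e0; have := cF x xU e e0; apply: filterS => y xy yU.
  by rewrite !E//; exact: xy.
- move=> x y xU yU; rewrite !E//; apply: le_trans (dF _ _ xU yU) _.
  by rewrite lee_fin le_max lexx.
- by move=> i iU; rewrite E ?vF//; exact: vertexpt_clos.
Qed.

Lemma extension (L0 : R) (d : nat) :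
  (forall k : nat, (1 <= k <= d)%N -> unif_connected R simp k) -> extendable L0 d.+1.
Proof.
elim: d => [_|d IH conn].
  by exists 0 => n Z psi _ Z1 _; exact: extension_base.
apply: extension_step => //; first by apply: conn; rewrite /= leqnn.
by apply: IH => k /andP[k1 kd]; apply: conn; rewrite k1 (leqW kd).
Qed.

End Extension.

(** * Overlap of finite complexes *)

Section Overlap.
Variables (R : realType) (q : nat).

Lemma sOv_ge n (Z : {set {set 'I_n}}) (f : ('I_n -> R) -> 'rV[R]_q) z :
  #|[set U in Z | `[< in_img Z f U z >]]%SET|%:R <= sOv Z f.
Proof.
apply: ub_le_sup; last by exists z.
exists #|Z|%:R => _ [y _ <-]; rewrite ler_nat; apply: subset_leq_card.
by apply/fintype.subsetP => U; rewrite inE => /andP[].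
Qed.

Lemma sOv_le n (Z : {set {set 'I_n}}) (f : ('I_n -> R) -> 'rV[R]_q) (c : R) :
  (forall z, #|[set U in Z | `[< in_img Z f U z >]]%SET|%:R <= c) -> sOv Z f <= c.
Proof.
move=> fc; apply: ge_sup => [|_ [z _ <-]//].
by exists (#|[set U in Z | `[< in_img Z f U 0 >]]%SET|%:R), 0.
Qed.

Lemma sOv_ge0 n (Z : {set {set 'I_n}}) (f : ('I_n -> R) -> 'rV[R]_q) : 0 <= sOv Z f.
Proof. exact: le_trans (sOv_ge Z f 0). Qed.

Lemma sTO_le n (Z : {set {set 'I_n}}) (f : ('I_n -> R) -> 'rV[R]_q) :
  fcont Z f -> sTO R Z q <= sOv Z f.
Proof.
move=> cf; apply: ge_inf; last by exists f.
by exists 0 => _ [g _ <-]; exact: sOv_ge0.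
Qed.

Lemma fcont_cst n (Z : {set {set 'I_n}}) (c : 'rV[R]_q) : fcont Z (fun=> c).
Proof. by move=> x _ e e0; exists 1 => // y _ _; rewrite subrr enorm0. Qed.

Lemma le_sTO n (Z : {set {set 'I_n}}) (c : R) :
  (forall f : ('I_n -> R) -> 'rV[R]_q, fcont Z f -> c <= sOv Z f) -> c <= sTO R Z q.
Proof.
move=> hc; apply: lb_le_inf => [|_ [f cf <-]]; last exact: hc.
by exists (sOv Z (fun=> 0 : 'rV[R]_q)), (fun=> 0) => //; exact: fcont_cst.
Qed.

Lemma sTO_bound n (Z : {set {set 'I_n}}) : sTO R Z q <= (2 ^ n)%:R.
Proof.
apply: le_trans (sTO_le (@fcont_cst n Z 0)) _; apply: sOv_le => z.
rewrite ler_nat; apply: leq_trans (max_card _) _.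
by rewrite -cardsT -powersetT card_powerset cardsT card_ord.
Qed.

Lemma sTO_le_sTOX (S : choiceType) (simp : set {fset S}) (r n : nat)
    (Z : {set {set 'I_n}}) :
  fasc Z -> (n <= r)%N -> embeds Z simp -> sTO R Z q <= sTOX R simp q r.
Proof.
move=> fZ nr eZ; apply: ub_le_sup; last by exists n, Z.
exists (2 ^ r)%:R => _ [m [Z' [_ [mr [_ ->]]]]].
by apply: le_trans (sTO_bound _) _; rewrite ler_nat leq_exp2l.
Qed.

Lemma sTOX_le (S : choiceType) (simp : set {fset S}) (r : nat) (c : R) :
  (forall n (Z : {set {set 'I_n}}), fasc Z -> (n <= r)%N -> embeds Z simp ->
     sTO R Z q <= c) ->
  sTOX R simp q r <= c.
Proof.
move=> hc; apply: ge_sup => [|_ [n [Z [fZ [nr [eZ ->]]]]]]; last exact: hc.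
(* The empty complex shows that the supremum is over a nonempty set. *)
exists (sTO R (finset.set0 : {set {set 'I_0}}) q), 0%N, finset.set0; split.
  by split=> [[]//|A B]; rewrite inE.
split=> //; split=> //.
exists (fun i : 'I_0 => match i with Ordinal m h => False_rect S (notF h) end).
by split=> [[]//|U]; rewrite inE.
Qed.

Definition vsupp n (x : 'I_n -> R) : {set 'I_n} := [set i | x i != 0]%SET.

Lemma fpt_clos n (Z : {set {set 'I_n}}) (x : 'I_n -> R) : fpt Z x ->
  vsupp x \in Z /\ clos (vsupp x) x.
Proof.
move=> [x01 [U UZ [xU x1]]].
have -> : vsupp x = U.
  by apply/setP => i; rewrite inE; apply/idP/idP => /xU.
split=> //; split.
- by move=> i; case/andP: (x01 i).
- rewrite (bigID (mem U))/= x1 big1 ?addr0// => i iU.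
  by apply/eqP; apply: contraNT iU => /xU.
- by move=> i iU; apply/eqP; apply: contraNT iU => /xU.
Qed.

Lemma fpt_supp_clos n (Z : {set {set 'I_n}}) (U : {set 'I_n}) (x : 'I_n -> R) :
  fpt Z x -> (forall i, x i != 0 -> i \in U) -> clos U x.
Proof.
move=> /fpt_clos[_ xs] xU; apply: closS xs.
by apply/fintype.subsetP => i; rewrite inE; exact: xU.
Qed.

(** If [z] is the image of a point [x] of [U], then the support [T] of [h x] is a simplex of [Z']
    whose image under [f] contains [z]. Each such [T] arises from at most [K] simplices [U]. *)
Lemma sOv_comp n n' (Z : {set {set 'I_n}}) (Z' : {set {set 'I_n'}})
    (h : ('I_n -> R) -> 'I_n' -> R) (f : ('I_n' -> R) -> 'rV[R]_q) (K : nat) :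
  (forall x, fpt Z x -> fpt Z' (h x)) ->
  (forall T, #|[set U in Z | `[< exists x, [/\ fpt Z x, clos U x & vsupp (h x) = T] >]]%SET|
     <= K)%N ->
  sOv Z (fun x => f (h x)) <= K%:R * sOv Z' f.
Proof.
move=> hZ fib; apply: sOv_le => z.
apply: le_trans (ler_wpM2l _ (sOv_ge Z' f z)); last exact: ler0n.
rewrite -natrM ler_nat; set B := [set T in Z' | _]%SET.
pose Fib T := [set U in Z | `[< exists x, [/\ fpt Z x, clos U x & vsupp (h x) = T] >]]%SET.
apply: (@leq_trans #|\bigcup_(T in B) Fib T|%SET).
  apply: subset_leq_card; apply/fintype.subsetP => U; rewrite inE.
  case/andP=> UZ /asboolP[x [xZ [xU xz]]].
  apply/finset.bigcupP; exists (vsupp (h x)); last first.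
    rewrite inE UZ; apply/asboolP; exists x; split=> //.
    exact: fpt_supp_clos xZ xU.
  rewrite inE (fpt_clos (hZ _ xZ)).1; apply/asboolP; exists (h x); split.
    exact: hZ.
  by split=> // i hi; rewrite inE.
rewrite mulnC -sum_nat_const.
apply: (@big_ind2 _ _ (fun (A : {set {set 'I_n}}) m => #|A| <= m)%N).
- by rewrite cards0.
- move=> A1 m1 A2 m2 h1 h2; apply: leq_trans (leq_add h1 h2).
  by rewrite cardsU leq_subr.
- by move=> T _; exact: fib.
Qed.

End Overlap.

(** * The full subcomplex on a finite list of vertices *)

Section FullSubcomplex.
Variables (R : realType) (S : choiceType) (simp : set {fset S}) (V : seq S).
Hypotheses (simpP : asc simp) (Vuniq : uniq V).

Let v (i : 'I_(size V)) : S := tnth (in_tuple V) i.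

Definition full_subcomplex : {set {set 'I_(size V)}} :=
  [set T : {set 'I_(size V)} | `[< simp [fset v i | i in T]%fset >]]%SET.

Lemma full_subcomplexP (T : {set 'I_(size V)}) :
  reflect (simp [fset v i | i in T]%fset) (T \in full_subcomplex).
Proof. by rewrite finset.in_set; exact: asboolP. Qed.

Definition restrict (p : S -> R) (i : 'I_(size V)) : R := p (v i).

Lemma full_subcomplex_inj : injective v.
Proof. by move=> i j; exact/tuple_uniqP. Qed.

Lemma full_subcomplex_fasc : fasc full_subcomplex.
Proof.
split=> [i|A B].
  apply/full_subcomplexP; apply: (simpP.2 [fset v i]%fset); first exact: simpP.1.
  by move=> x /imfsetP[j /= /finset.set1P -> ->]; rewrite inE.
move=> /full_subcomplexP sA /fintype.subsetP BA; apply/full_subcomplexP.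
apply: (simpP.2 _ _ sA) => x /imfsetP[j /= /BA jA ->].
by apply/imfsetP; exists j.
Qed.

Lemma full_subcomplex_embeds : embeds full_subcomplex simp.
Proof.
exists v; split; first exact: full_subcomplex_inj.
by move=> U /full_subcomplexP.
Qed.

Lemma restrict_fpt (p : S -> R) : realpt simp p -> (forall s, p s != 0 -> s \in V) ->
  fpt full_subcomplex (restrict p).
Proof.
move=> rp pV; have [p01 [U [sU [pU _]]]] := rp.
split=> [i|]; first exact: p01.
exists (vsupp (restrict p)).
  apply/full_subcomplexP; apply: (simpP.2 _ _ sU) => x /imfsetP[i /=].
  by rewrite inE => pi ->; apply/pU.
split=> [i|]; first by rewrite inE.
(* The support lies in [V], so restriction loses no weight. *)
have p1 : \sum_(s <- [fset s in V]%fset) p s = 1.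
  apply: (realpt_sum rp) => s; rewrite inE /= => sV.
  by apply/eqP; apply: contraNT sV => /pV.
rewrite -[RHS]p1 (perm_big V) /=; last first.
  by apply: uniq_perm; rewrite ?fset_uniq// => s; rewrite inE.
rewrite [RHS]big_tnth [RHS](bigID (mem (vsupp (restrict p))))/=.
rewrite [X in _ + X]big1 ?addr0// => i.
by rewrite inE negbK => /eqP.
Qed.

End FullSubcomplex.

(** * Fibre counting and the comparison of overlaps *)

Lemma card_preim_seq (T : finType) (S : eqType) (psi : T -> S) (N : nat) (L : seq S) :
  (forall y, #|[set i | psi i == y]%SET| <= N)%N ->
  (#|[set i | psi i \in L]%SET| <= N * size L)%N.
Proof.
move=> psiN; elim: L => [|y L IH].
  by rewrite (_ : [set i | _]%SET = finset.set0) ?cards0//; apply/setP => i; rewrite !inE.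
rewrite (_ : [set i | _]%SET = [set i | psi i == y] :|: [set i | psi i \in L])%SET.
  apply: leq_trans (_ : _ <= N + N * size L)%N _; last by rewrite -mulnS.
  by apply: leq_trans (leq_add (psiN y) IH); rewrite cardsU leq_subr.
by apply/setP => i; rewrite !inE.
Qed.

Theorem theorem1p2 (R : realType) (SX SY : countType)
  (simpX : set {fset SX}) (simpY : set {fset SY}) (d : nat) (phi : SX -> SY) :
  asc simpX -> asc simpY ->
  bounded_degree simpX -> bounded_degree simpY ->
  dimension simpX d ->
  (forall k : nat, (1 <= k <= d)%N -> unif_connected R simpY k) ->
  regular R simpX simpY phi ->
  forall q : nat, (1 <= q)%N ->
    exists C : nat, forall r : nat,
      sTOX R simpX q r <= C%:R * sTOX R simpY q (C * r) + C%:R.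
Proof.
move=> aX aY _ degY [_ dimX] conn [[L [L0 phiL]] [N phiN]] q _.
(* Adjacent vertices have images at path distance at most [L], hence at [cdist] at most
   [2 * (L + 1)]. *)
have [D ext] := @extension R SY simpY aY (2 * (L + 1)) d conn.
have [K cK] := bounded_degree_dim aY degY.
(* [M] converts the diameter bound [D] into a number of edges, and [B] bounds the size of balls of
   that radius. *)
have [M HM] := @cdist_gball R SY simpY aY K D cK.
have [B HB] := gball_finite degY M.
have /choice[Lb HLb] : forall u, exists Lu : seq SY, (size Lu <= B)%N /\
    forall v, gball simpY u M v -> v \in Lu.
  by move=> u; have [Lu] := HB u; exists Lu.
(* The power of 2 bounds the loss in overlap, and [B] the growth of the vertex count; their sum
   serves for both. *)
exists (2 ^ (N * B) + B)%N => r; apply: sTOX_le => n Z fZ nr [emb [emb_inj embZ]].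
pose psi i := phi (emb i).
have [F HF] : exists F, extends_over simpY Z psi D F.
  apply: ext; first exact: fZ.2.
  - move=> U UZ; have := dimX _ (embZ U UZ).
    by rewrite card_imfset //= -cardE.
  - move=> U i j UZ iU jU; apply: gdist_cdist => //.
    apply: le_trans (phiL _ _) _; rewrite -[leRHS]mule1.
    apply: lee_wpmul2l; first by rewrite lee_fin ltW.
    apply: gdist_edge; apply: (simp_pair aX (embZ U UZ)).
      by apply/imfsetP; exists i.
    by apply/imfsetP; exists j.
pose V := undup (flatten [seq Lb (psi i) | i <- enum 'I_n]).
have sV : (size V <= n * B)%N.
  apply: leq_trans (size_undup _) _; rewrite size_flatten /shape -map_comp.
  rewrite -[X in (_ <= X * _)%N](size_enum_ord n).
  elim: (enum 'I_n) => //= i s IH; rewrite mulSn leq_add//.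
  by case: (HLb (psi i)).
pose Z' := full_subcomplex simpY V.
pose h (x : 'I_n -> R) := @restrict R SY V (F x).
(* Both directions are needed: balls around [psi i] place [F x] inside [V], while balls around a
   vertex of the support of [F x] limit the possible [U]. *)
have near U x i : U \in Z -> clos U x -> i \in U ->
    [/\ realpt simpY (F x), forall s, F x s != 0 -> gball simpY (psi i) M s &
        forall s, F x s != 0 -> gball simpY s M (psi i)].
  move=> UZ xU iU; have [rF _ dF vF] := HF _ UZ.
  have ic : clos U (vertexpt R i) by exact: vertexpt_clos.
  have pp : vertexpt R (psi i) (psi i) != 0 by rewrite /vertexpt eqxx oner_eq0.
  have rv := vertexpt_realpt R aY (psi i).
  split=> [|s xs|s xs]; first exact: rF.
    by apply: HM (rF _ xU) _ pp xs => //; rewrite -vF//; exact: dF.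
  by apply: HM (rF _ xU) rv _ xs pp => //; rewrite -vF//; exact: dF.
have hZ x : fpt Z x -> fpt Z' (h x).
  move=> /fpt_clos[UZ xU]; have [i iU _] := clos_nonempty xU.
  have [rFx xV _] := near _ _ _ UZ xU iU.
  apply: restrict_fpt => //; first exact: undup_uniq.
  move=> s /xV gs; rewrite mem_undup; apply/flattenP; exists (Lb (psi i)).
    by apply: map_f; rewrite mem_enum.
  by apply: (HLb _).2.
(* The support of a point is nonempty. Fix a vertex of [T]: every vertex of [U] is sent by [psi]
   into the ball around it, and at most [N * B] vertices are, so [U] is one of at most [2 ^ (N * B)]
   subsets. *)
have fib (T : {set 'I_(size V)}) : (#|[set U in Z |
    `[< exists x, [/\ fpt Z x, clos U x & vsupp (h x) = T] >]]%SET| <= 2 ^ (N * B))%N.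
  have [->|/set0Pn[j jT]] := eqVneq T finset.set0.
    rewrite (_ : [set U in Z | _]%SET = finset.set0) ?cards0//.
    apply/setP => U; rewrite !inE; apply/negP => /andP[_ /asboolP[x [xZ _ hx0]]].
    have [_ /clos_nonempty[j]] := fpt_clos (hZ _ xZ).
    by rewrite hx0 inE.
  pose vj := tnth (in_tuple V) j.
  apply: (@leq_trans #|powerset [set i | psi i \in Lb vj]%SET|).
    apply: subset_leq_card; apply/fintype.subsetP => U.
    rewrite !inE => /andP[UZ /asboolP[x [xZ xU hxT]]].
    apply/fintype.subsetP => i iU; rewrite inE; apply: (HLb _).2.
    have [_ _] := near _ _ _ UZ xU iU; apply.
    by move: jT; rewrite -hxT inE.
  rewrite card_powerset leq_exp2l//.
  apply: leq_trans (_ : _ <= N * size (Lb vj))%N _; last first.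
    by rewrite leq_mul2l (HLb vj).1 orbT.
  apply: card_preim_seq => y.
  (* As [emb] is injective, the fibre bound for [phi] passes to [psi]. *)
  have := phiN y [fset emb i | i in [set i | psi i == y]%SET]%fset.
  rewrite card_imfset //= -cardE; apply => x /imfsetP[i /=].
  by rewrite inE => /eqP <- ->.
have cF : cont_on simpY [set x | exists2 U, U \in Z & clos U x] F.
  by apply: cont_on_pasting => U /HF[].
have hcont (f : ('I_(size V) -> R) -> 'rV[R]_q) : fcont Z' f -> fcont Z (fun x => f (h x)).
  move=> cf x xZ e e0; have [del del0 Hdel] := cf _ (hZ _ xZ) e e0.
  have inZ (y : 'I_n -> R) : fpt Z y -> exists2 U, U \in Z & clos U y.
    by move=> /fpt_clos[UZ yU]; exists (vsupp y).
  have [d1 d10 Hd1] := cF _ (inZ _ xZ) del del0.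
  exists d1 => // y yZ xy; apply: Hdel; first exact: hZ.
  (* Coordinates are 1-Lipschitz for [cdist], so continuity into [Y] gives continuity in each
     coordinate. *)
  move=> i; apply: (@cdist_coord_lt _ _ simpY).
  by apply: Hd1 => //; exact: inZ.
have K0 : 0 < (2 ^ (N * B))%:R :> R by rewrite ltr0n expn_gt0.
have ZZ' : sTO R Z q <= (2 ^ (N * B))%:R * sTO R Z' q.
  (* Dividing by the constant leaves the infimum alone on the right, where it suffices to bound each
     [f] separately. *)
  rewrite mulrC -ler_pdivrMr//; apply: le_sTO => f cf.
  rewrite ler_pdivrMr// mulrC; apply: le_trans (sTO_le (hcont _ cf)) _.
  exact: sOv_comp hZ fib.
have Z'Y : sTO R Z' q <= sTOX R simpY q ((2 ^ (N * B) + B) * r).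
  apply: sTO_le_sTOX.
  - exact: full_subcomplex_fasc.
  - apply: leq_trans sV _; rewrite mulnC; apply: leq_mul => //.
    exact: leq_addl.
  - by apply: full_subcomplex_embeds; exact: undup_uniq.
have sY0 : 0 <= sTOX R simpY q ((2 ^ (N * B) + B) * r).
  apply: le_trans Z'Y; apply: le_sTO => f _; exact: sOv_ge0.
apply: le_trans ZZ' _; apply: ler_wpDr => //.
apply: ler_pM => //; first by apply: le_sTO => f _; exact: sOv_ge0.
by rewrite ler_nat leq_addr.
Qed.
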